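(* Let $\mathbb{F}_q$ be a finite field of characteristic $p$, let $r=p^t$ for some $t\ge1$, and assume that $\mathbb{F}_r$ is a subfield of $\mathbb{F}_q$. Fix $a\in\mathbb{F}_q$ and $\beta\in\mathbb{F}_q^\ast$. Choose $\lambda\in\mathbb{F}_q^\ast$ and arbitrary nonzero scalars $u_b\in\mathbb{F}_q^\ast$ for $b\in\mathbb{F}_r$. Let $\mathcal{A}=a+\beta\mathbb{F}_r=\{\alpha_b=a+\beta b: b\in\mathbb{F}_r\}$, and define the multiplier matrix $V\in(\mathbb{F}_q^\ast)^{2\times r}$, with columns indexed by $b\in\mathbb{F}_r$ (the column of $b$ corresponding to the evaluation point $\alpha_b$), by \[ v_{1,b}=u_b,\qquad v_{2,b}=\lambda u_b^{-1}. \] Then the HRS code $C=\operatorname{HRS}_r(\mathcal{A},V,2,r)$ is reverse self-dual.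
   Context: For an integer $h\ge 0$, $\mathcal{P}_{<h}=\{f\in\mathbb{F}_q[x]:\deg f<h\}$. Hasse derivative: for $f(x)=\sum_\ell f_\ell x^\ell\in\mathbb{F}_q[x]$ and $j\ge0$, $\partial^{(j)}f(x)=\sum_{\ell}\binom{\ell}{j}f_\ell x^{\ell-j}$ (with $\binom{\ell}{j}=0$ if $j>\ell$). Hyperderivative Reed–Solomon (HRS) code: for a set $\mathcal{A}=\{\alpha_1,\ldots,\alpha_r\}$ of $r$ distinct elements of $\mathbb{F}_q$, $V=(v_{i,j})\in(\mathbb{F}_q^\ast)^{s\times r}$ and $0\le k\le rs$, \[ \operatorname{HRS}_k(\mathcal{A},V,s,r)=\left\{\bigl(v_{i,j}\,\partial^{(i-1)}f(\alpha_j)\bigr)_{1\le i\le s,\,1\le j\le r}: f\in\mathcal{P}_{<k}\right\}\subseteq\operatorname{Mat}_{s\times r}(\mathbb{F}_q). \] Reverse bilinear form on $\operatorname{Mat}_{s\times r}(\mathbb{F}_q)$: $[A,B]_{\rm rev}=\sum_{j=1}^r\sum_{i=1}^s a_{i,j}b_{s-i+1,j}$. The reverse dual of a linear code $C$ is $C^{\perp_{\rm rev}}=\{B:[A,B]_{\rm rev}=0\text{ for all }A\in C\}$, and $C$ is reverse self-dual if $C=C^{\perp_{\rm rev}}$. *)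

(* Defs.v *)
From HB Require Import structures.
From mathcomp Require Import all_boot all_order all_algebra.

Set Implicit Arguments.
Unset Strict Implicit.
Unset Printing Implicit Defensive.

Import GRing.Theory.
Local Open Scope ring_scope.

(* Rows are numbered from 0, so row [i] carries the Hasse derivative of order  *)
(* [i]; this is [f^`N(i)], with ['C(l, i)] times [f`_l] in degree [l - i].     *)
Definition hrs_word (F : nzRingType) (s r : nat) (alpha : 'I_r -> F)
    (V : 'M[F]_(s, r)) (f : {poly F}) : 'M[F]_(s, r) :=
  \matrix_(i < s, j < r) (V i j * (f^`N(i)).[alpha j]).

(* [{poly_k F}] is the type of polynomials of degree < k. The standing         *)
(* requirements of the code (the points [alpha j] are pairwise distinct, the   *)
(* entries of [V] are nonzero, k <= r * s) are not built into the definition.  *)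
Definition HRS (F : finFieldType) (k s r : nat) (alpha : 'I_r -> F)
    (V : 'M[F]_(s, r)) : {set 'M[F]_(s, r)} :=
  [set hrs_word alpha V f | f : {poly_k F}].

Definition rev_form (F : nzRingType) (s r : nat) (A B : 'M[F]_(s, r)) : F :=
  \sum_(j < r) \sum_(i < s) A i j * B (rev_ord i) j.

Definition rev_dual (F : finFieldType) (s r : nat) (C : {set 'M[F]_(s, r)}) :
    {set 'M[F]_(s, r)} :=
  [set B | [forall A in C, rev_form A B == 0]].

Definition rev_self_dual (F : finFieldType) (s r : nat)
    (C : {set 'M[F]_(s, r)}) : Prop :=
  C = rev_dual C.

(* Main.v *)
Require Import Defs.
From HB Require Import structures.
From mathcomp Require Import all_boot all_order all_algebra.
From mathcomp Require Import zify ring.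

Set Implicit Arguments.
Unset Strict Implicit.
Unset Printing Implicit Defensive.

Import GRing.Theory.
Local Open Scope ring_scope.

(** For words of [f] and [g], the products [v_{1,b} v_{2,b}] are the constant
    [lambda], so the reverse form is [lambda] times the sum of [(f g)'] over the
    points.  After the substitution [x = a + beta X] this is a sum over [F_r] of
    a polynomial [h'] of degree at most [2 r - 3]; power sums over [F_r] kill
    every monomial except [X^(r-1)], whose coefficient [r h_r] vanishes in
    characteristic [p].  Conversely, given [B] in the dual, interpolate its
    first row by some [g] of degree less than [r]; the word of [g] minus [B] is
    in the dual and has zero first row, and testing it against Lagrange
    polynomials shows that its second row vanishes as well. *)

Section PowerSums.

Variables (F : finFieldType) (K : {set F}).
Hypothesis K_subfield : GRing.divring_closed K.

Lemma subfield_mem_mul c b : c \in K -> c != 0 -> (c * b \in K) = (b \in K).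
Proof.
case: K_subfield => K1 _ Kdiv Kc c0.
have KV x : x \in K -> x^-1 \in K by move=> Kx; rewrite -div1r Kdiv.
have KM x y : x \in K -> y \in K -> x * y \in K.
  by move=> Kx Ky; rewrite -[y]invrK Kdiv // KV.
apply/idP/idP => [Kcb|]; last exact: KM.
by rewrite -(mulKf c0 b) KM // KV.
Qed.

Lemma card_subfield_units : #|[pred b in K | b != 0]| = #|K|.-1.
Proof.
have K0 : 0 \in K by case: K_subfield => K1 KB _; rewrite -(subrr 1) KB.
rewrite (cardD1 0 K) K0; apply: eq_card => b.
by rewrite !inE andbC.
Qed.

(** Multiplication by [c] permutes the nonzero elements of [K], so it preserves their product [P],
    while pulling out one factor [c] per element. *)
Lemma subfield_fermat c : c \in K -> c != 0 -> c ^+ #|K|.-1 = 1.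
Proof.
move=> Kc c0; pose P := \prod_(b in [pred b in K | b != 0]) b.
have P0 : P != 0 by apply/prodf_neq0 => b; rewrite inE => /andP[].
apply: (mulIf P0); rewrite mul1r -card_subfield_units -prodr_const -big_split.
rewrite /P [RHS](reindex_inj (mulfI c0)) /=; apply: eq_bigl => b.
by rewrite !inE subfield_mem_mul // mulf_eq0 negb_or c0.
Qed.

(** Reindexing by multiplication by [c] turns the sum into [c ^+ m] times itself, so it suffices to
    find a nonzero [c] in [K] with [c ^+ m != 1]. *)
Lemma subfield_power_sum m :
  ~~ (#|K|.-1 %| m)%N -> \sum_(b in K) b ^+ m = 0.
Proof.
move=> ndvd; have [c /and3P[Kc c0 cm]] :
    exists c, [&& c \in K, c != 0 & c ^+ m != 1].
  apply/existsP; apply: contraR ndvd; rewrite negb_exists => /forallP Hc.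
  apply: contraT => ndvd; set n := #|K|.-1 in ndvd.
  have n0 : (0 < n)%N.
    rewrite /n -card_subfield_units; apply/card_gt0P; exists 1.
    by rewrite !inE oner_neq0 andbT; case: K_subfield.
  (* If no such [c] existed, all [n] nonzero elements of [K] would be roots of this polynomial,
     whose degree [m %% n] is positive and less than [n]. *)
  have q0 : 'X^(m %% n) - 1 != 0 :> {poly F}.
    by rewrite -size_poly_gt0 size_XnsubC // lt0n.
  have rt : all (root ('X^(m %% n) - 1)) (enum [pred b in K | b != 0]).
    apply/allP => b; rewrite mem_enum inE => /andP[Kb b0].
    have := Hc b; rewrite Kb b0 negbK {1}(divn_eq m n) exprD mulnC exprM.
    rewrite subfield_fermat // expr1n mul1r => /eqP bm.
    by rewrite rootE !hornerE bm subrr.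
  have := max_poly_roots q0 rt (enum_uniq _).
  rewrite size_XnsubC ?lt0n // -cardE card_subfield_units ltnS.
  by rewrite leqNgt ltn_mod n0.
apply/eqP; have : (c ^+ m - 1) * (\sum_(b in K) b ^+ m) == 0.
  rewrite mulrBl mul1r subr_eq0 mulr_sumr; apply/eqP.
  rewrite [RHS](reindex_inj (mulfI c0)) /=.
  apply: eq_big => b; first by rewrite subfield_mem_mul.
  by rewrite exprMn.
by rewrite mulf_eq0 subr_eq0 (negPf cm).
Qed.

(** The size bound leaves only exponents below [2 * (#|K| - 1)] in the derivative, so the multiples
    of [#|K| - 1] among them are [0] and [#|K| - 1]. *)
Lemma subfield_sum_deriv (h : {poly F}) :
    #|K|%:R = 0 :> F -> (1 < #|K|)%N -> (size h <= (2 * #|K|).-1)%N ->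
  \sum_(b in K) h^`().[b] = 0.
Proof.
move=> chK K_gt1 sh; have sh' : (size h^`() <= (2 * #|K|).-2)%N.
  have [->|/lt_size_deriv] := eqVneq h 0; first by rewrite deriv0 size_poly0.
  by lia.
under eq_bigr do rewrite (horner_coef_wide _ sh').
rewrite exchange_big big1 //= => i _; rewrite -mulr_sumr.
case: (eqVneq (i : nat) #|K|.-1) => [->|iK].
  by rewrite coef_deriv prednK 1?ltnW // -mulr_natr chK mulr0 mul0r.
(* Since [0 ^+ 0 = 1], the power sum for exponent [0] is [#|K|] copies of [1], which is zero by
   [chK]. *)
have [->|i0] := eqVneq (i : nat) 0%N.
  by rewrite sumr_const chK mulr0.
rewrite subfield_power_sum ?mulr0 //; apply/dvdnP => -[k ik].
case: k ik => [|[|k]] ik.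
- by rewrite ik mul0n in i0.
- by rewrite ik mul1n eqxx in iK.
have : (2 * #|K|.-1 < (2 * #|K|).-2)%N.
  by apply: leq_ltn_trans (ltn_ord i); rewrite ik leq_mul2r orbT.
by move: K_gt1; move: #|K| => n; lia.
Qed.

End PowerSums.

Lemma poly_interpolation (F : fieldType) r (x : 'I_r -> F) (y : 'I_r -> F) :
  injective x -> exists f : {poly_r F}, forall j, f.[x j] = y j.
Proof.
move=> x_inj; pose L i := \prod_(j < r | j != i) ('X - (x j)%:P).
have sL i : (size (L i) <= r)%N.
  rewrite size_prod => [|j _]; last by rewrite polyXsubC_eq0.
  under eq_bigr do rewrite size_XsubC.
  (* The product of [r - 1] linear factors has size [r] because the index [i] forces [0 < r]. *)
  by rewrite sum_nat_const cardC1 card_ord; have := ltn_ord i; lia.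
have L0 i : (L i).[x i] != 0.
  rewrite horner_prod; apply/prodf_neq0 => j ji.
  by rewrite hornerXsubC subr_eq0 inj_eq // eq_sym.
pose f := \sum_(i < r) (y i / (L i).[x i]) *: L i.
have sf : (size f <= r)%N.
  rewrite (leq_trans (size_sum _ _ _)) //; apply/bigmax_leqP => i _.
  exact: leq_trans (size_scale_leq _ _) (sL i).
exists (npolyp r f) => j; rewrite npolypK // horner_sum (bigD1 j) //= big1.
  by rewrite hornerZ divfK // addr0.
move=> i ij; rewrite hornerZ [X in _ * X]horner_prod (bigD1 j) 1?eq_sym //=.
by rewrite hornerXsubC subrr mul0r mulr0.
Qed.

Theorem theorem12 (F : finFieldType) (p t r : nat)
    (p_char : p \in [pchar F]) (t_ge1 : (1 <= t)%N) (r_def : r = (p ^ t)%N)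
    (K : {set F}) (K_subfield : GRing.divring_closed K) (K_card : #|K| = r)
    (e : 'I_r -> F) (e_inj : injective e) (e_img : [set e j | j : 'I_r] = K)
    (a beta lambda : F) (beta_neq0 : beta != 0) (lambda_neq0 : lambda != 0)
    (u : F -> F) (u_neq0 : {in K, forall b, u b != 0}) :
  rev_self_dual
    (HRS r (fun j => a + beta * e j)
       (\matrix_(i < 2, j < r)
          if i == 0 then u (e j) else lambda * (u (e j))^-1)).
Proof.
have p_prime : prime p := pcharf_prime p_char.
have r_gt1 : (1 < r)%N by rewrite r_def -(exp1n t) ltn_exp2r ?prime_gt1.
have r_char : r%:R = 0 :> F.
  by apply/eqP; rewrite -(dvdn_pcharf p_char) r_def dvdn_exp.
have Ke j : e j \in K by rewrite -e_img imset_f.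
have ue j : u (e j) != 0 by rewrite u_neq0.
set alpha := fun j => _; set V := \matrix_(i, j) _.
have alpha_inj : injective alpha by move=> i j /addrI/(mulfI beta_neq0)/e_inj.
have V0 j : V 0 j = u (e j) by rewrite mxE.
have V1 j : V 1 j = lambda / u (e j) by rewrite mxE.
(* With two rows, [rev_ord] swaps the row indices [0] and [1]. *)
have formE (A B : 'M[F]_(2, r)) :
    rev_form A B = \sum_(j < r) (A 0 j * B 1 j + A 1 j * B 0 j).
  apply: eq_bigr => j _; rewrite big_ord_recl big_ord1.
  by congr (A _ _ * B _ _ + A _ _ * B _ _); apply: val_inj.
have word0 f j : hrs_word alpha V f 0 j = u (e j) * f.[alpha j].
  by rewrite mxE V0 nderivn0.
have word1 f j : hrs_word alpha V f 1 j = lambda / u (e j) * f^`().[alpha j].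
  by rewrite mxE V1 nderivn1.
have orth (f g : {poly_r F}) :
    rev_form (hrs_word alpha V f) (hrs_word alpha V g) = 0.
  pose l := a%:P + beta *: 'X; pose h := ((f : {poly F}) * g) \Po l.
  have sl : size l = 2%N.
    by rewrite /l addrC size_polyDl size_scale ?size_polyX // ltnS size_polyC_leq1.
  have := @subfield_sum_deriv F K K_subfield h.
  rewrite K_card -e_img big_imset => [/(_ r_char r_gt1) sum0|]; last first.
    by move=> i j _ _ /e_inj.
  (* By the chain rule the derivative of [h] carries a factor [beta], so [beta] times the form is
     compared with [lambda] times the vanishing sum. *)
  apply: (mulfI beta_neq0); rewrite mulr0 -[RHS](mulr0 lambda).
  rewrite -[in RHS]sum0; last first.
    rewrite size_comp_poly2 // (leq_trans (size_polyMleq _ _)) //.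
    by rewrite mul2n -addnn -!subn1 leq_sub2r // leq_add ?size_npoly.
  rewrite formE !mulr_sumr; apply: eq_bigr => j _; rewrite !word0 !word1.
  rewrite deriv_comp derivM /l !(hornerE, horner_comp, derivE) -/(alpha j).
  by rewrite /=; field.
rewrite /rev_self_dual; apply/setP => B; apply/imsetP/idP => [[g _ ->]|].
  by rewrite inE; apply/'forall_implyP => _ /imsetP[f _ ->]; rewrite orth.
rewrite inE => /'forall_implyP Bdual.
have [g gE] := poly_interpolation (fun j => B 0 j / u (e j)) alpha_inj.
exists g => //; apply/matrixP => i j.
have B0 k : B 0 k = hrs_word alpha V g 0 k by rewrite word0 gE mulrC divfK.
suff B1 : B 1 j = hrs_word alpha V g 1 j.
  have /orP[/eqP->|/eqP->] : (i == 0) || (i == 1) by case: i => [[|[|]]].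
    exact: B0.
  exact: B1.
(* The first row of the word of [f] is supported on column [j] alone, which isolates the entry
   [B 1 j]. *)
have [f fE] := poly_interpolation (fun k => (k == j)%:R : F) alpha_inj.
have /Bdual/eqP : hrs_word alpha V f \in HRS r alpha V by apply: imset_f.
(* The word of [f] pairs to zero with both [B] and the word of [g]. As these share their first row,
   the sums involving the second row of the word of [f] cancel. *)
rewrite -[RHS](orth f g) !formE !big_split /=.
under [X in _ + X = _]eq_bigr do rewrite B0.
move/addIr; rewrite (bigD1 j) //= big1 => [|k kj]; last first.
  by rewrite word0 fE (negPf kj) mulr0 mul0r.
rewrite [RHS](bigD1 j) //= big1 => [|k kj]; last first.
  by rewrite word0 fE (negPf kj) mulr0 mul0r.
by rewrite !addr0 word0 fE eqxx mulr1 => /(mulfI (ue j)).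
Qed.
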